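(* Let $X$ be a compact Hausdorff space with at least two points, and let $0<\epsilon<1/4$. If $\varphi\in C(X)'$ is $\epsilon$-disjointness preserving and $\|\varphi\|=1$, then there exist $\alpha\in\mathbb{K}$ and $x\in X$ such that $\|\varphi-\alpha\delta_x\|\le o_X(\epsilon)$. On the other hand, there exists an $\epsilon$-disjointness preserving $\varphi\in C(X)'$ with $\|\varphi\|=1$ such that $\|\varphi-\alpha\delta_x\|\ge o_X(\epsilon)$ for every $\alpha\in\mathbb{K}$ and every $x\in X$.
   Context: $\mathbb{K}$ denotes $\mathbb{R}$ or $\mathbb{C}$. $C(X)$ is the Banach space of $\mathbb{K}$-valued continuous functions on $X$ with the sup norm $\|\cdot\|_\infty$, $C(X)'$ is its dual space with the dual norm, and $\delta_x(f):=f(x)$. A functional $\varphi\in C(X)'$ is $\epsilon$-disjointness preserving if $|\varphi(f)||\varphi(g)|\le\epsilon$ whenever $f,g\in C(X)$ satisfy $\|f\|_\infty=\|g\|_\infty=1$ and $fg\equiv 0$. For $n\in\mathbb{N}$ (so $n \geq 1$) put $\omega_n:=\frac{n^2-1}{4n^2}$ and $\mathbb{A}_n:=[\omega_{2n-1},\omega_{2n+1})$; the sets $\mathbb{A}_n$ partition $[0,1/4)$. The function $o_X:(0,1/4)\to\mathbb{R}$ is defined as follows: for $n\in\mathbb{N}$ and $\epsilon\in\mathbb{A}_n$, $o_X(\epsilon):=\frac{2n-1-\sqrt{1-4\epsilon}}{2n}$ if $2n\le\mathrm{card}\,X$ (in particular if $X$ is infinite); $o_X(\epsilon):=\frac{k-1-\sqrt{1-4\epsilon}}{k}$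 if $k:=\mathrm{card}\,X<2n$ and $k$ is even; $o_X(\epsilon):=\frac{k-1}{k}$ if $k:=\mathrm{card}\,X<2n$ and $k$ is odd. *)

(* Defs.v *)
From HB Require Import structures.
From mathcomp Require Import all_boot all_order all_algebra finmap.
From mathcomp Require Import complex zify ring.
From mathcomp Require Import all_classical all_reals all_analysis.

Set Implicit Arguments.
Unset Strict Implicit.
Unset Printing Implicit Defensive.

Import Order.TTheory GRing.Theory Num.Theory.
Import numFieldNormedType.Exports.
Local Open Scope classical_set_scope.
Local Open Scope complex_scope.
Local Open Scope card_scope.
Local Open Scope ring_scope.

Variant scalar_kind := RealScalars | ComplexScalars.

Definition scalar_field (R : realType) (k : scalar_kind) : numFieldType :=
  match k with RealScalars => R | ComplexScalars => R[i] end.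

Definition of_real (R : realType) (k : scalar_kind) : R -> scalar_field R k :=
  match k with RealScalars => id | ComplexScalars => fun x => x%:C end.
Arguments of_real {R} k.

(* The norm of a numFieldType takes its values in the field itself; modulus is
   the same norm read in R, see modulusE *)
Definition modulus (R : realType) (k : scalar_kind) : scalar_field R k -> R :=
  match k with
  | RealScalars => fun x => `|x|
  | ComplexScalars => fun z => complex.Re `|z|
  end.
Arguments modulus {R k}.

Section scalar_theory.
Context {R : realType} {k : scalar_kind}.
Implicit Types (x y : R) (z w : scalar_field R k).

Lemma modulusE z : `|z| = of_real k (modulus z).
Proof. by case: k z. Qed.

Lemma of_realD x y : of_real k (x + y) = of_real k x + of_real k y.
Proof. by case: k => //=; rewrite rmorphD. Qed.

Lemma of_realM x y : of_real k (x * y) = of_real k x * of_real k y.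
Proof. by case: k => //=; rewrite rmorphM. Qed.

Lemma of_real0 : of_real k 0 = 0 :> scalar_field R k.
Proof. by case: k. Qed.

Lemma of_real1 : of_real k 1 = 1 :> scalar_field R k.
Proof. by case: k. Qed.

Lemma of_real_inj : injective (@of_real R k).
Proof. by case: k => x y //= []. Qed.

Lemma ler_of_real x y : (of_real k x <= of_real k y) = (x <= y).
Proof. by case: k => //=; rewrite lecR. Qed.

Lemma ltr_of_real x y : (of_real k x < of_real k y) = (x < y).
Proof. by rewrite !lt_neqAle ler_of_real (inj_eq of_real_inj). Qed.

Lemma modulus_ge0 z : 0 <= modulus z.
Proof. by rewrite -ler_of_real of_real0 -modulusE. Qed.

Lemma modulus_of_real x : modulus (of_real k x) = `|x|.
Proof.
apply: of_real_inj; rewrite -modulusE; case: k => //=.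
by rewrite normc_def /= expr0n addr0 sqrtr_sqr.
Qed.

Lemma modulusM z w : modulus (z * w) = modulus z * modulus w.
Proof. by apply: of_real_inj; rewrite of_realM -!modulusE normrM. Qed.

Lemma modulusD z w : modulus (z + w) <= modulus z + modulus w.
Proof. by rewrite -ler_of_real of_realD -!modulusE ler_normD. Qed.

Lemma modulus_dist z w : `|modulus z - modulus w| <= modulus (z - w).
Proof.
have h (a b : scalar_field R k) : modulus a - modulus b <= modulus (a - b).
  by rewrite lerBlDr; apply: le_trans (modulusD _ _); rewrite subrK.
rewrite ler_norml h andbT lerNl opprB.
by rewrite (_ : modulus (z - w) = modulus (w - z)) ?h//; apply: of_real_inj;
  rewrite -!modulusE distrC.
Qed.

Lemma modulus_eq0 z : modulus z = 0 -> z = 0.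
Proof. by move=> h; apply/eqP; rewrite -normr_eq0 modulusE h of_real0. Qed.

Lemma modulus_continuous : continuous (@modulus R k).
Proof.
move=> z; apply/(@cvgrPdist_lt _ R _ (nbhs z)) => e e0.
have e0' : 0 < of_real k e by rewrite -of_real0 ltr_of_real.
have : \forall w \near z, `|z - w| < of_real k e.
  by apply/nbhs_normP; exists (of_real k e).
apply: (@filterS _ (nbhs z)) => w; rewrite modulusE ltr_of_real.
exact: le_lt_trans (modulus_dist _ _).
Qed.

End scalar_theory.

HB.mixin Record isCompactHausdorff X of Topological X := {
  compactT : compact [set: X];
  hausdorffT : hausdorff_space X
}.

#[short(type="compactHausdorffType")]
HB.structure Definition CompactHausdorff := {X of isCompactHausdorff X & Topological X}.

Definition Cspace (R : realType) (k : scalar_kind) (X : compactHausdorffType) :=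
  continuousType X (scalar_field R k).

Section Cspace_theory.
Context {R : realType} {k : scalar_kind} {X : compactHausdorffType}.
Local Notation K := (scalar_field R k).
Local Notation CX := (Cspace R k X).
Implicit Types f g h : CX.

HB.instance Definition _ := Choice.on CX.

Lemma Cspace_ext f g : (forall x, f x = g x) -> f = g.
Proof. by move=> fg; apply/continuousEP. Qed.

Let ccst (c : K) : continuous (fun _ : X => c).
Proof. by move=> x; exact: cvg_cst. Qed.

Let cadd f g : continuous (fun x => f x + g x).
Proof. by move=> x; apply: cvgD; exact: cts_fun. Qed.

Let copp f : continuous (fun x => - f x).
Proof. by move=> x; apply: cvgN; exact: cts_fun. Qed.

Let cscale (c : K) f : continuous (fun x => c * f x).
Proof. by move=> x; apply: cvgMr; exact: cts_fun. Qed.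

Definition Cspace_zero : CX := mkcts (@ccst 0).
Definition Cspace_add f g : CX := mkcts (@cadd f g).
Definition Cspace_opp f : CX := mkcts (@copp f).
Definition Cspace_scale (c : K) f : CX := mkcts (@cscale c f).

Let addA : associative Cspace_add.
Proof. by move=> f g h; apply: Cspace_ext => x; exact: addrA. Qed.

Let addC : commutative Cspace_add.
Proof. by move=> f g; apply: Cspace_ext => x; exact: addrC. Qed.

Let add0 : left_id Cspace_zero Cspace_add.
Proof. by move=> f; apply: Cspace_ext => x; exact: add0r. Qed.

Let addN : left_inverse Cspace_zero Cspace_opp Cspace_add.
Proof. by move=> f; apply: Cspace_ext => x; exact: addNr. Qed.

HB.instance Definition _ := GRing.isZmodule.Build CX addA addC add0 addN.

Let scaleA a b f : Cspace_scale a (Cspace_scale b f) = Cspace_scale (a * b) f.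
Proof. by apply: Cspace_ext => x; exact: mulrA. Qed.

Let scale1 : left_id 1 Cspace_scale.
Proof. by move=> f; apply: Cspace_ext => x; exact: mul1r. Qed.

Let scaleDr : right_distributive Cspace_scale +%R.
Proof. by move=> a f g; apply: Cspace_ext => x; exact: mulrDr. Qed.

Let scaleDl f : {morph Cspace_scale^~ f : a b / a + b}.
Proof. by move=> a b; apply: Cspace_ext => x; exact: mulrDl. Qed.

HB.instance Definition _ :=
  GRing.Zmodule_isLmodule.Build K CX scaleA scale1 scaleDr scaleDl.

Lemma CspaceD f g x : (f + g) x = f x + g x. Proof. by []. Qed.
Lemma CspaceN f x : (- f) x = - f x. Proof. by []. Qed.
Lemma CspaceZ (a : K) f x : (a *: f) x = a * f x. Proof. by []. Qed.

(* X may be empty, in which case sup_norm f is 0 *)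
Definition sup_norm f : R := sup [set modulus (f x) | x in [set: X]].

Lemma modulus_has_ubound f : has_ubound [set modulus (f x) | x in [set: X]].
Proof.
have cf : continuous ((@modulus R k : K -> R) \o f).
  by move=> x; apply: continuous_comp; [exact: cts_fun|exact: modulus_continuous].
have /compact_bounded[M [Mr hM]] : compact (((@modulus R k : K -> R) \o f) @` [set: X]).
  by apply: continuous_compact compactT; exact: continuous_subspaceT.
exists (M + 1) => _ [x _ <-].
rewrite (le_trans (ler_norm _))//; apply: (hM (M + 1)); first by rewrite ltrDl.
by exists x.
Qed.

Lemma sup_norm_ub f x : modulus (f x) <= sup_norm f.
Proof. by apply: ub_le_sup; [exact: modulus_has_ubound|exists x]. Qed.

Lemma sup_norm_le f (M : R) :
  0 <= M -> (forall x, modulus (f x) <= M) -> sup_norm f <= M.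
Proof.
move=> M0 fM; rewrite /sup_norm.
have [->|/set0P S0] := eqVneq [set modulus (f x) | x in [set: X]] set0.
  by rewrite sup0.
by apply: ge_sup => // _ [x _ <-].
Qed.

Lemma sup_norm_ge0 f : 0 <= sup_norm f.
Proof.
rewrite /sup_norm.
have [->|/set0P[_ [x _ _]]] := eqVneq [set modulus (f x) | x in [set: X]] set0.
  by rewrite sup0.
exact: le_trans (modulus_ge0 _) (sup_norm_ub f x).
Qed.

Let normD f g :
  of_real k (sup_norm (f + g)) <= of_real k (sup_norm f) + of_real k (sup_norm g).
Proof.
rewrite -of_realD ler_of_real; apply: sup_norm_le => [|x].
  by rewrite addr_ge0// sup_norm_ge0.
by rewrite (le_trans (modulusD _ _))// lerD// sup_norm_ub.
Qed.

Let normZ (a : K) f :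
  of_real k (sup_norm (a *: f)) = `|a| * of_real k (sup_norm f).
Proof.
rewrite modulusE -of_realM; congr of_real; apply/eqP; rewrite eq_le.
apply/andP; split.
  apply: sup_norm_le => [|x]; first by rewrite mulr_ge0 ?modulus_ge0 ?sup_norm_ge0.
  by rewrite modulusM ler_wpM2l ?modulus_ge0 ?sup_norm_ub.
have [->|a0] := eqVneq (modulus a) 0; first by rewrite mul0r sup_norm_ge0.
have a1 : 0 < modulus a by rewrite lt_neqAle eq_sym a0 modulus_ge0.
rewrite mulrC -ler_pdivlMr//; apply: sup_norm_le => [|x].
  by rewrite divr_ge0 ?sup_norm_ge0 ?modulus_ge0.
by rewrite ler_pdivlMr// mulrC -modulusM; exact: (sup_norm_ub (a *: f)).
Qed.

Let norm_eq0 f : of_real k (sup_norm f) = 0 -> f = 0.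
Proof.
rewrite -of_real0 => /of_real_inj f0; apply: Cspace_ext => x.
apply: modulus_eq0; apply/eqP; rewrite eq_le modulus_ge0 andbT -f0.
exact: sup_norm_ub.
Qed.

HB.instance Definition _ := Lmodule_isNormed.Build K CX normD normZ norm_eq0.

Lemma CspaceE f : `|f| = of_real k (sup_norm f). Proof. by []. Qed.

Definition dirac_functional (x : X) : CX -> K^o := fun f => f x.

Let dirac_linear x : linear (dirac_functional x).
Proof. by []. Qed.

HB.instance Definition _ x :=
  GRing.isLinear.Build K CX K^o *:%R (dirac_functional x) (dirac_linear x).

(* sup is 0 on unbounded sets: dual_norm is only meaningful on bounded
   functionals *)
Definition dual_norm (phi : CX -> K^o) : R :=
  sup [set modulus (phi f : K) | f in [set f | `|f| <= 1]].

Lemma dual_norm_has_ubound (phi : {linear CX -> K^o}) : continuous phi ->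
  has_ubound [set modulus (phi f : K) | f in [set f | `|f| <= 1]].
Proof.
move=> /(_ 0)/continuous_linear_bounded-/(_ 0)/linear_boundedP[M [Mr hM]].
exists (modulus M + 1) => _ [f /= f1 <-].
have /hM : M < of_real k (modulus M + 1).
  rewrite of_realD -modulusE of_real1.
  by rewrite (le_lt_trans (real_ler_norm Mr))// ltrDl.
move=> /(_ f) h; rewrite -(@ler_of_real R k) -modulusE (le_trans h)// ler_piMr//.
by rewrite -(@of_real0 R k) ler_of_real addr_ge0// modulus_ge0.
Qed.

Lemma dirac_continuous x : continuous (dirac_functional x).
Proof.
apply: bounded_linear_continuous; apply/linear_boundedP.
exists 1; split => // r r1 f; rewrite (@le_trans _ _ `|f|)//.
  by rewrite [leLHS]modulusE CspaceE ler_of_real sup_norm_ub.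
by rewrite ler_peMl// ltW.
Qed.

Definition disjointness_preserving (eps : R) (phi : CX -> K^o) :=
  forall f g : CX, `|f| = 1 -> `|g| = 1 -> (forall x, f x * g x = 0) ->
    modulus (phi f : K) * modulus (phi g : K) <= eps.

End Cspace_theory.

Section o_X.
Context {R : realType}.

Definition omega (n : nat) : R := (n%:R ^+ 2 - 1) / (4 * n%:R ^+ 2).

Definition bbA (n : nat) : set R :=
  [set eps | omega n.*2.-1 <= eps < omega n.*2.+1].

(* the index n for which eps is in bbA n; it exists and is unique for
   0 <= eps < 1/4, see bbA_cover and bbA_indexE *)
Definition bbA_index (eps : R) : nat := xget 0%N [set n | (0 < n)%N /\ bbA n eps].

(* if `I_n.*2 does not embed in X then X is finite, so that k is its cardinal
   in the last two cases *)
Definition oX (X : topologicalType) (eps : R) : R :=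
  let n := bbA_index eps in
  let k := #|` fset_set [set: X]| in
  let s := Num.sqrt (1 - 4 * eps) in
  if `I_n.*2 #<= [set: X] then (2 * n%:R - 1 - s) / (2 * n%:R)
  else if odd k then (k%:R - 1) / k%:R
  else (k%:R - 1 - s) / k%:R.

Let omegaE (n : nat) : (0 < n)%N -> omega n = 4^-1 - 4^-1 * (n%:R ^+ 2)^-1.
Proof. by move=> n0; rewrite /omega; field; rewrite pnatr_eq0 -lt0n. Qed.

Lemma omega_homo (m n : nat) : (0 < m)%N -> (m <= n)%N -> omega m <= omega n.
Proof.
move=> m0 mn; have n0 := leq_trans m0 mn.
rewrite !omegaE// lerD2l lerN2 ler_wpM2l// lef_pV2 ?posrE ?exprn_gt0 ?ltr0n//.
by rewrite ler_sqr ?nnegrE ?ler0n// ler_nat.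
Qed.

Lemma bbA_inj (m n : nat) (eps : R) :
  (0 < m)%N -> (0 < n)%N -> bbA m eps -> bbA n eps -> m = n.
Proof.
wlog mn : m n / (m <= n)%N.
  by move=> h m0 n0 Am An; case/orP: (leq_total m n) => ?; [|apply/esym]; apply: h.
move=> m0 n0 /andP[_ m1] /andP[n1 _]; apply/eqP; rewrite eqn_leq mn leqNgt.
apply/negP => lt_mn.
have lt_omega := le_lt_trans n1 m1.
have : omega m.*2.+1 <= omega n.*2.-1.
  by apply: omega_homo => //; move: lt_mn m0; clear; lia.
by rewrite leNgt lt_omega.
Qed.

Lemma bbA_indexE (n : nat) (eps : R) : (0 < n)%N -> bbA n eps -> bbA_index eps = n.
Proof.
move=> n0 An; rewrite /bbA_index; case: xgetP => [m _ [m0 Am]|/(_ n) []//].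
exact: bbA_inj Am An.
Qed.

Lemma bbA_cover (eps : R) : 0 <= eps < 4^-1 -> exists2 n, (0 < n)%N & bbA n eps.
Proof.
move=> /andP[e0 e1].
have ex : exists n : nat, eps < omega n.*2.+1.
  pose d := (4 * (4^-1 - eps))^-1.
  have d0 : 0 < d by rewrite invr_gt0 mulr_gt0// subr_gt0.
  exists (Num.truncn d).+1.
  set n := (Num.truncn d).+1; set p : R := (n.*2.+1)%:R.
  have dp : d < p.
    apply: lt_le_trans (truncnS_gt d) _.
    by rewrite ler_nat -/n -addnn ltnW// ltnS leq_addr.
  have p1 : 1 <= p by rewrite ler1n.
  rewrite omegaE// -/p ltrBrDl -ltrBrDr.
  have -> : 4^-1 - eps = 4^-1 * d^-1 by rewrite invrK; field.
  rewrite ltr_pM2l// ltf_pV2 ?posrE ?exprn_gt0 ?(lt_le_trans _ p1)//.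
  by apply: lt_le_trans dp _; rewrite expr2 ler_peMl// (le_trans _ p1).
case: (ex_minnP ex) => -[|n] ltn minn.
  by move: ltn; rewrite /omega expr1n subrr mul0r ltNge e0.
exists n.+1 => //; apply/andP; split=> //=.
by rewrite leNgt; apply/negP => /minn; rewrite ltnn.
Qed.

End o_X.

(* Main.v *)
(* No measure is needed: mass U, the supremum of |phi f| over the f with
   |f| <= 1 vanishing off U, is additive enough on open sets to play the part
   of the total variation of phi.  With s = sqrt (1 - 4 eps), disjointness
   preservation reads mass U (1 - mass U) <= eps, so masses of open sets avoid
   the interval ((1 - s) / 2, (1 + s) / 2) of length s.  Points of mass below s
   cannot carry a set across this gap, hence whenever two closed sets contain
   all points of mass at least s, one of them has mass at least (1 + s) / 2.
   For eps in A_n we have 1 / (2n + 1) < s <= 1 / (2n - 1), so there are at most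
   2n such points; split into two halves, they yield a point x of mass at least
   (1 + s) / (2n).  A norm-preserving extension of phi restricted to the
   functions vanishing at x differs from phi by some alpha delta_x, and so
   |phi - alpha delta_x| <= 1 - mass of x.
   The bound is attained by a discrete measure with 2n - 1 points of weight
   (1 + s) / (2n) and the remaining weight on one further point.  If X has
   k < 2n points, k plays the part of 2n when it is even, and the uniform
   probability is extremal when it is odd. *)
From HB Require Import structures.
Require Import Defs.
From mathcomp Require Import all_boot all_order all_algebra finmap.
From mathcomp Require Import complex zify ring lra.
From mathcomp Require Import all_classical all_reals all_analysis.

Set Implicit Arguments.
Unset Strict Implicit.
Unset Printing Implicit Defensive.

Import Order.TTheory GRing.Theory Num.Theory.
Import numFieldNormedType.Exports.
Local Open Scope classical_set_scope.
Local Open Scope ring_scope.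

(** * Scalars: real and complex moduli, common points of families of discs *)

Section scalars.
Context {R : realType} {k : scalar_kind}.
Local Notation K := (scalar_field R k).
Implicit Types z w : K.

Lemma of_realN (x : R) : of_real k (- x) = - of_real k x.
Proof. by apply/eqP; rewrite -addr_eq0 -of_realD addNr of_real0. Qed.

Lemma of_real_sum (T : Type) (l : seq T) (w : T -> R) :
  of_real k (\sum_(x <- l) w x) = \sum_(x <- l) of_real k (w x).
Proof. exact: (big_morph _ of_realD of_real0). Qed.

Lemma modulus0 : modulus (0 : K) = 0.
Proof. by rewrite -(@of_real0 R k) modulus_of_real normr0. Qed.

Lemma modulus1 : modulus (1 : K) = 1.
Proof. by rewrite -(@of_real1 R k) modulus_of_real normr1. Qed.

Lemma modulusN z : modulus (- z) = modulus z.
Proof. by apply: (@of_real_inj R k); rewrite -!modulusE normrN. Qed.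

Lemma modulusB z w : modulus (z - w) <= modulus z + modulus w.
Proof. by rewrite -(modulusN w) modulusD. Qed.

Lemma of_real_continuous : continuous (of_real k : R -> K).
Proof.
case: k => x /=; first exact: cvg_id.
apply/cvgrPdist_lt => e /= e0.
have er : e = (complex.Re e)%:C%C.
  by rewrite RRe_real// realE ltW.
rewrite er ltcR in e0 *.
near=> t.
rewrite -rmorphB /= normc_def /= expr0n addr0 sqrtr_sqr ltcR.
near: t; exact: cvgr_dist_lt.
Unshelve. all: by end_near. Qed.

Lemma unimodular_align z :
  exists2 c : K, modulus c = 1 & c * z = of_real k (modulus z).
Proof.
have [->|z0] := eqVneq z 0.
  by exists 1; rewrite ?modulus1// mulr0 modulus0 of_real0.
have m0 : modulus z != 0 by apply: contra_neq z0 => /modulus_eq0.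
exists (of_real k (modulus z) / z); last by rewrite divfK.
apply: (mulIf m0).
by rewrite -modulusM divfK// modulus_of_real mul1r ger0_norm// modulus_ge0.
Qed.

End scalars.

(* Helly's theorem for intervals. *)
Lemma interval_common_point (R : realType) (I : Type) (c d : I -> R) (i0 : I) :
  (forall i j, c i - d i <= c j + d j) ->
  exists a, forall i, `|c i - a| <= d i.
Proof.
move=> h; pose S := range (fun i => c i - d i).
have ubS j : ubound S (c j + d j) by move=> _ [i _ <-].
exists (sup S) => i; rewrite ler_distlC; apply/andP; split.
  apply: (@ub_le_sup _ S); first by exists (c i + d i).
  by exists i => //; rewrite /=.
by apply: ge_sup => //; exists (c i0 - d i0), i0.
Qed.

(** Helly for intervals applies to real and imaginary parts separately, so the error is at most
    [sqrt 2 * d i]. The factor 2 is harmless, since [d i] becomes arbitrarily small where this is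
    used. *)
Lemma scalar_common_point (R : realType) (k : scalar_kind) (I : Type)
    (c : I -> scalar_field R k) (d : I -> R) (i0 : I) :
  (forall i j, modulus (c i - c j) <= d i + d j) ->
  exists a, forall i, modulus (c i - a) <= 2 * d i.
Proof.
case: k c => /= c h.
  have [i j|a ha] := @interval_common_point R I c d i0.
    by have := le_trans (ler_norm _) (h i j); lra.
  exists a => i; apply: le_trans (ha i) _.
  rewrite mulr2n mulrDl mul1r lerDl.
  by have := h i i; rewrite subrr normr0; lra.
have re_le (z : R[i]) : `|complex.Re z| <= complex.Re `|z|.
  by rewrite normc_def /= -sqrtr_sqr ler_sqrt ?lerDl ?sqr_ge0// addr_ge0// sqr_ge0.
have im_le (z : R[i]) : `|complex.Im z| <= complex.Re `|z|.
  by rewrite normc_def /= -sqrtr_sqr ler_sqrt ?lerDr ?sqr_ge0// addr_ge0// sqr_ge0.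
have [i j|a ha] := @interval_common_point R I (fun i => complex.Re (c i)) d i0.
  have := le_trans (le_trans (ler_norm _) (re_le _)) (h i j).
  by case: (c i) (c j) => ? ? [? ?] /=; lra.
have [i j|b hb] := @interval_common_point R I (fun i => complex.Im (c i)) d i0.
  have := le_trans (le_trans (ler_norm _) (im_le _)) (h i j).
  by case: (c i) (c j) => ? ? [? ?] /=; lra.
exists (a +i* b)%C => i.
have := ha i; have := hb i.
case: (c i) => u v /= hv hu.
have d0 : 0 <= d i by apply: le_trans hu.
rewrite -[2 * d i]ger0_norm ?mulr_ge0// -sqrtr_sqr ler_sqrt ?sqr_ge0//.
rewrite -[X in X + _]real_normK ?num_real// -[X in _ + X]real_normK ?num_real//.
move: hu hv; set p := `|u - a|; set q := `|v - b| => hu hv.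
have p0 : 0 <= p by exact: normr_ge0.
have q0 : 0 <= q by exact: normr_ge0.
nra.
Qed.

(** * Urysohn functions, separation and finite covers *)

Section compact_hausdorff.
Context {R : realType} {X : compactHausdorffType}.
Implicit Types (A B F O : set X).

Lemma Urysohn_function A B : closed A -> closed B -> A `&` B = set0 ->
  exists h : X -> R, [/\ continuous h, forall x, 0 <= h x <= 1,
    forall x, A x -> h x = 0 & forall x, B x -> h x = 1].
Proof.
move=> cA cB AB0.
have nX : normal_space X by apply: compact_normal; [exact: hausdorffT|exact: compactT].
have /(@uniform_separatorP _ R)[h [ch h01 hA hB]] :=
  (@normal_separatorP R X).1 nX _ _ cA cB AB0.
exists h; split => // x.
- by have /= := h01 (h x) (imageT _ _); rewrite in_itv.
- by move=> Ax; apply: hA; exists x.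
- by move=> Bx; apply: hB; exists x.
Qed.

Lemma finite_set_closed A : finite_set A -> closed A.
Proof.
move: A; apply/accessible_finite_set_closed/hausdorff_accessible.
exact: hausdorffT.
Qed.

Lemma closed_singleton (x : X) : closed [set x].
Proof. exact: finite_set_closed. Qed.

Lemma separate_closed A B : closed A -> closed B -> A `&` B = set0 ->
  exists U V, [/\ open U, open V, A `<=` U, B `<=` V & U `&` V = set0].
Proof.
apply: (@normal_openP R X).1.
by apply: compact_normal; [exact: hausdorffT|exact: compactT].
Qed.

Lemma compactHausdorff_cover (P : X -> set X) :
  (forall x, open (P x)) -> (forall x, P x x) ->
  exists s : seq X, forall y, exists2 x, x \in s & P x y.
Proof.
move=> oP Px.
have [/(_ _)|/existsNP[x0 _]] := pselect (forall x : X, False).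
  by move=> X0; exists [::] => y; have := X0 y.
pose X' : ptopologicalType := HB.pack_for ptopologicalType X (isPointed.Build X x0).
have := @compactT X; rewrite (@compact_cover X').
move=> /(_ X setT P (fun x _ => oP x))[y _|D _ hD]; first by exists y.
by exists (enum_fset D) => y; have [x xD Pxy] := hD y I; exists x.
Qed.

End compact_hausdorff.

(** * Products with real cutoff functions *)

Section cutoff.
Context {R : realType} {k : scalar_kind} {X : compactHausdorffType}.
Local Notation K := (scalar_field R k).
Local Notation CX := (Cspace R k X).
Implicit Types (f g : CX) (h : X -> R).

Let cutoff_continuous h f : continuous h ->
  continuous (fun x => of_real k (h x) * f x).
Proof.
move=> ch x; apply: cvgM; last exact: cts_fun.
by apply: continuous_comp; [exact: ch|exact: of_real_continuous].
Qed.

Definition cutoff h (ch : continuous h) f : CX := mkcts (@cutoff_continuous h f ch).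

Let one_continuous : continuous (fun _ : X => 1 : K).
Proof. by move=> x; exact: cvg_cst. Qed.

Definition Cspace_one : CX := mkcts one_continuous.

Lemma cutoffE h (ch : continuous h) f x : cutoff ch f x = of_real k (h x) * f x.
Proof. by []. Qed.

Lemma Cspace_oneE x : Cspace_one x = 1. Proof. by []. Qed.

Lemma norm_le1E f : (`|f| <= 1) = (sup_norm f <= 1).
Proof. by rewrite CspaceE -(@of_real1 R k) ler_of_real. Qed.

Lemma norm_le1P f : `|f| <= 1 <-> forall x, modulus (f x) <= 1.
Proof.
rewrite norm_le1E; split => [f1 x|]; last exact: sup_norm_le.
by apply: le_trans f1; exact: sup_norm_ub.
Qed.

Lemma modulus_cutoff h (ch : continuous h) f x : 0 <= h x <= 1 ->
  modulus (cutoff ch f x) <= modulus (f x).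
Proof.
move=> /andP[h0 h1]; rewrite cutoffE modulusM modulus_of_real ger0_norm//.
by rewrite ler_piMl// modulus_ge0.
Qed.

Lemma modulus_fun_continuous f : continuous (fun x => modulus (f x)).
Proof.
by move=> x; apply: continuous_comp; [exact: cts_fun|exact: modulus_continuous].
Qed.

(* [f] is uniformly close to a function vanishing where [f] is small, which
   stands in for inner regularity of a measure. *)
Lemma truncation f (e : R) : 0 < e -> exists g, exists W C : set X,
  [/\ open W, closed C, W `<=` C, (forall x, C x -> f x != 0) &
  [/\ forall x, modulus (g x) <= modulus (f x),
      forall x, modulus (f x - g x) <= e & forall x, ~ W x -> g x = 0]].
Proof.
move=> e0; set m := fun x => modulus (f x).
have cm : continuous m := @modulus_fun_continuous f.
have cle (c : R) : closed [set x | m x <= c].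
  apply: (@preimage_closed _ _ m [set y | y <= c]);
    [by move=> x _; exact: cm|exact: closed_le].
have cge (c : R) : closed [set x | c <= m x].
  apply: (@preimage_closed _ _ m [set y | c <= y]);
    [by move=> x _; exact: cm|exact: closed_ge].
(* The Urysohn function is 0 where [m <= e / 2] and 1 where [m >= e], so [f] is altered only where
   its modulus is below [e]. *)
have [|h [ch h01 hA hB]] := @Urysohn_function R X _ _ (cle (e / 2)) (cge e).
  by apply/seteqP; split => // x [/= a b]; move: (le_trans b a); lra.
exists (cutoff ch f), [set x | e / 2 < m x], [set x | e / 2 <= m x]; split.
- apply: (@open_comp _ _ m [set y | e / 2 < y]);
    [by move=> x _; exact: cm|exact: open_gt].
- exact: cge.
- by move=> x /= /ltW.
- by move=> x /=; rewrite /m; apply: contraTneq => ->; rewrite modulus0; lra.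
split => x; first exact/modulus_cutoff/h01.
- rewrite cutoffE -[X in X - _]mul1r -(@of_real1 R k) -mulrBl -of_realN -of_realD.
  rewrite modulusM modulus_of_real.
  have [/hB hx|] := leP e (m x).
    by rewrite hx subrr normr0 mul0r ltW.
  rewrite -/(m x) => mx; have := h01 x; move=> /andP[h0 h1].
  rewrite ger0_norm ?subr_ge0//; apply: le_trans (ltW mx).
  by rewrite ler_piMl ?modulus_ge0// gerBl.
- by move=> /negP; rewrite -leNgt => /hA hx; rewrite cutoffE hx of_real0 mul0r.
Qed.

End cutoff.

(** * Mass: additivity properties and regularity *)

Section mass.
Context {R : realType} {k : scalar_kind} {X : compactHausdorffType}.
Local Notation K := (scalar_field R k).
Local Notation CX := (Cspace R k X).
Variable phi : {linear CX -> K^o}.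
Hypothesis phi_continuous : continuous phi.
Implicit Types (f g : CX) (U V W F : set X) (x : X).

(* The total variation of the measure representing [phi] on an open set [U],
   obtained without representing [phi]. *)
Definition mass U : R := sup [set modulus (phi f : K) | f in
  [set f : CX | `|f| <= 1 /\ forall x, ~ U x -> f x = 0]].

Lemma mass_ub U f : (forall x, modulus (f x) <= 1) ->
  (forall x, ~ U x -> f x = 0) -> modulus (phi f : K) <= mass U.
Proof.
move=> f1 fU; apply: ub_le_sup; last by exists f => //; split => //; exact/norm_le1P.
have [M hM] := dual_norm_has_ubound phi_continuous.
by exists M => _ [g [g1 _] <-]; apply: hM; exists g.
Qed.

Lemma mass_le U (M : R) :
  (forall f, (forall x, modulus (f x) <= 1) -> (forall x, ~ U x -> f x = 0) ->
    modulus (phi f : K) <= M) -> mass U <= M.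
Proof.
move=> hM; apply: ge_sup.
  by exists (modulus (phi 0 : K)), 0 => //; split => //; rewrite normr0.
by move=> _ [f [f1 fU] <-]; apply: hM => //; exact/norm_le1P.
Qed.

Lemma mass_approx U (e : R) : 0 < e -> exists f,
  [/\ forall x, modulus (f x) <= 1, forall x, ~ U x -> f x = 0 &
      mass U - e < modulus (phi f : K)].
Proof.
move=> e0; apply: contrapT => nh.
suff : mass U <= mass U - e by rewrite leNgt gtrBl e0.
apply: mass_le => f f1 fU; rewrite leNgt; apply/negP => h.
by apply: nh; exists f.
Qed.

Lemma mass_ge0 U : 0 <= mass U.
Proof.
apply: le_trans (mass_ub (f := 0) _ _) => //; first exact: modulus_ge0.
by move=> x; rewrite modulus0 ler01.
Qed.

Lemma le_mass U V : U `<=` V -> mass U <= mass V.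
Proof.
move=> UV; apply: mass_le => f f1 fU; apply: mass_ub => // x Vx.
by apply: fU => /UV.
Qed.

Lemma mass_bound U f (c : R) : 0 < c -> (forall x, modulus (f x) <= c) ->
  (forall x, ~ U x -> f x = 0) -> modulus (phi f : K) <= c * mass U.
Proof.
move=> c0 fc fU; have cn : c != 0 by rewrite gt_eqF.
have -> : f = of_real k c *: (of_real k c^-1 *: f).
  apply: Cspace_ext => x.
  by rewrite !CspaceZ mulrA -of_realM divff// of_real1 mul1r.
rewrite linearZ modulusM modulus_of_real gtr0_norm// ler_pM2l//.
apply: mass_ub => x; last by move=> /fU fx; rewrite CspaceZ fx mulr0.
by rewrite CspaceZ modulusM modulus_of_real gtr0_norm ?invr_gt0// ler_pdivrMl// mulr1.
Qed.

Lemma mass_setT : mass setT = dual_norm phi.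
Proof.
apply/eqP; rewrite eq_le; apply/andP; split.
  apply: mass_le => f f1 _; apply: ub_le_sup; first exact: dual_norm_has_ubound.
  by exists f => //; exact/norm_le1P.
apply: ge_sup; first by exists (modulus (phi 0 : K)), 0 => //=; rewrite normr0.
by move=> _ [f /= /norm_le1P f1 <-]; apply: mass_ub => // x /(_ I).
Qed.

(** Inner regularity: a nearly optimal [f] for [U] is replaced by its truncation, which lives in a
    closed subset of [U]; a uniformly small change of [f] changes [phi f] little. *)
Lemma mass_inner U (e : R) : 0 < e -> exists W C,
  [/\ open W, closed C, W `<=` C, C `<=` U & mass U - e <= mass W].
Proof.
move=> e0; have e20 : 0 < e / 2 by rewrite divr_gt0.
have [f [f1 fU hf]] := mass_approx U e20.
(* Chosen to give [d * mass setT <= e / 2]; the [+ 1] keeps the denominator positive. *)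
pose d := e / 2 / (mass setT + 1).
have m1 : 0 < mass setT + 1 by rewrite ltr_wpDl// mass_ge0.
have d0 : 0 < d by rewrite divr_gt0.
have [g [W [C [oW cC WC Cf [gf fg gW]]]]] := truncation f d0.
exists W, C; split => //.
  by move=> x /Cf; apply: contra_neqP => /fU.
have hg : modulus (phi g : K) <= mass W.
  by apply: mass_ub => // x; apply: le_trans (f1 x).
have : modulus (phi (f - g) : K) <= d * mass setT.
  by apply: mass_bound => // x /(_ I).
have : d * mass setT <= e / 2.
  by rewrite /d mulrAC ler_pdivrMr// ler_wpM2l ?ltW// ltrDl.
have := modulusD (phi (f - g) : K) (phi g : K).
rewrite -linearD subrK.
by move: hf hg; lra.
Qed.

(** Unimodular factors turn [phi f] and [phi g] into nonnegative reals, whose sum is the value of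
    [phi] at a single function; disjoint supports keep its modulus at most 1. *)
Lemma mass_disjointU U V : U `&` V = set0 -> mass U + mass V <= mass (U `|` V).
Proof.
move=> UV0; rewrite -lerBrDr; apply: mass_le => f f1 fU.
rewrite lerBrDr addrC -lerBrDr; apply: mass_le => g g1 gV.
rewrite lerBrDr addrC.
have [c c1 cf] := unimodular_align (phi f : K).
have [d d1 dg] := unimodular_align (phi g : K).
have -> : modulus (phi f : K) + modulus (phi g : K) =
    modulus (phi (c *: f + d *: g) : K).
  rewrite linearD !linearZ [X in modulus (X + _)]cf [X in modulus (_ + X)]dg.
  by rewrite -of_realD modulus_of_real ger0_norm// addr_ge0 ?modulus_ge0.
apply: mass_ub => x.
  rewrite CspaceD !CspaceZ; have [Ux|/fU ->] := pselect (U x).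
    rewrite gV ?mulr0 ?addr0 ?modulusM ?c1 ?mul1r//.
    by move=> Vx; have : (U `&` V) x by []; rewrite UV0.
  by rewrite mulr0 add0r modulusM d1 mul1r.
by move=> UVx; rewrite CspaceD !CspaceZ fU ?gV ?mulr0 ?addr0// => h; apply: UVx;
  [right|left].
Qed.

(** By inner regularity it suffices to test functions living in a closed [C] inside the union. On
    [C], [h] and [1 - h] form a partition of unity: [h f] vanishes off [U] and [(1 - h) f] off
    [V]. *)
Lemma mass_openU U V : open U -> open V -> mass (U `|` V) <= mass U + mass V.
Proof.
move=> oU oV; apply/ler_addgt0Pr => e e0.
have [W [C [oW cC WC CUV hW]]] := mass_inner (U `|` V) e0.
rewrite -lerBlDr; apply: le_trans hW _.
have clCD U' : open U' -> closed (C `\` U').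
  by move=> oU'; apply: closedI => //; exact: open_closedC.
have [|h [ch h01 hU hV]] := @Urysohn_function R X _ _ (clCD _ oU) (clCD _ oV).
  by apply/seteqP; split => // x [[Cx nU] [_ nV]]; case: (CUV x Cx).
apply: mass_le => f f1 fW.
have -> : f = cutoff ch f + (f - cutoff ch f) by rewrite addrC subrK.
have e1 x : (f - cutoff ch f) x = of_real k (1 - h x) * f x.
  by rewrite CspaceD CspaceN cutoffE of_realD of_realN of_real1 mulrBl mul1r.
rewrite linearD (le_trans (modulusD _ _))// lerD//; apply: mass_ub => x.
- exact: le_trans (modulus_cutoff ch f (h01 x)) (f1 x).
- move=> Ux; rewrite cutoffE; have [Cx|Cx] := pselect (C x).
    by rewrite hU ?of_real0 ?mul0r.
  by rewrite fW ?mulr0// => /WC.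
- rewrite e1 modulusM modulus_of_real; have /andP[h0 h1] := h01 x.
  by rewrite ger0_norm ?subr_ge0// mulr_ile1 ?subr_ge0 ?modulus_ge0// gerBl.
- move=> Vx; rewrite e1; have [Cx|Cx] := pselect (C x).
    by rewrite hV ?subrr ?of_real0 ?mul0r.
  by rewrite fW ?mulr0// => /WC.
Qed.

Lemma mass_openC U F : open U -> closed F -> F `<=` U ->
  mass setT <= mass U + mass (~` F).
Proof.
move=> oU cF FU; apply: le_trans (mass_openU oU (closed_openC cF)).
by apply: le_mass => x _; have [/FU|] := pselect (F x); [left|right].
Qed.

(** Outer regularity: the neighbourhood is the complement of a closed set that nearly exhausts the
    complement of [F]. *)
Lemma mass_nbhs F (c : R) : closed F -> mass setT - mass (~` F) < c ->
  exists2 U, open U /\ F `<=` U & mass U < c.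
Proof.
move=> cF hc; pose e := (c - (mass setT - mass (~` F))) / 2.
have e0 : 0 < e by rewrite divr_gt0// subr_gt0.
have [W [C [oW cC WC CF hW]]] := mass_inner (~` F) e0.
exists (~` C); first by split; [exact: closed_openC|exact: subsetCr].
have CW0 : ~` C `&` W = set0 by apply/seteqP; split => // x [nC /WC].
have := mass_disjointU CW0; have : mass (~` C `|` W) <= mass setT by exact: le_mass.
by move: hW; rewrite /e; lra.
Qed.

Lemma mass_disjointness_preserving (eps : R) : disjointness_preserving eps phi ->
  0 <= eps -> forall U V, U `&` V = set0 -> mass U * mass V <= eps.
Proof.
move=> dphi eps0 U V UV0.
(* Disjointness preservation speaks of norm exactly 1. Dividing by a norm that is at most 1 keeps
   all zeros and does not decrease the value of [phi]. *)
have scale f (f0 : f != 0) : (forall x, modulus (f x) <= 1) -> exists2 g : CX,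
    `|g| = 1 & (forall x, f x = 0 -> g x = 0) /\
      modulus (phi f : K) <= modulus (phi g : K).
  move=> /norm_le1P f1; have n0 : `|f| != 0 by rewrite normr_eq0.
  have ni : `| (`|f|^-1 : K)| = `|f|^-1 by rewrite ger0_norm// invr_ge0.
  exists (`|f|^-1 *: f); first by rewrite normrZ ni mulVf.
  split; first by move=> x fx; rewrite CspaceZ fx mulr0.
  rewrite linearZ modulusM ler_peMl ?modulus_ge0//.
  by rewrite -(@ler_of_real R k) -modulusE ni of_real1 invf_ge1// normr_gt0.
have key f g : (forall x, modulus (f x) <= 1) -> (forall x, modulus (g x) <= 1) ->
    (forall x, f x * g x = 0) -> modulus (phi f : K) * modulus (phi g : K) <= eps.
  move=> f1 g1 fg0.
  have [->|/scale/(_ f1)[f' nf [hf lf]]] := eqVneq f 0.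
    by rewrite linear0 modulus0 mul0r.
  have [->|/scale/(_ g1)[g' ng [hg lg]]] := eqVneq g 0.
    by rewrite linear0 modulus0 mulr0.
  apply: le_trans (ler_pM (modulus_ge0 _) (modulus_ge0 _) lf lg) _.
  apply: dphi => // x; have /eqP := fg0 x; rewrite mulf_eq0 => /orP[]/eqP.
    by move=> /hf ->; rewrite mul0r.
  by move=> /hg ->; rewrite mulr0.
have [V0|Vn] := eqVneq (mass V) 0; first by rewrite V0 mulr0.
have Vp : 0 < mass V by rewrite lt_neqAle eq_sym Vn mass_ge0.
rewrite -ler_pdivlMr//; apply: mass_le => f f1 fU.
rewrite ler_pdivlMr//.
have [f0|fn] := eqVneq (modulus (phi f : K)) 0; first by rewrite f0 mul0r.
have fp : 0 < modulus (phi f : K) by rewrite lt_neqAle eq_sym fn modulus_ge0.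
rewrite mulrC -ler_pdivlMr//; apply: mass_le => g g1 gV.
rewrite ler_pdivlMr// mulrC; apply: key => // x.
have [Ux|/fU ->] := pselect (U x); last by rewrite mul0r.
rewrite gV ?mulr0// => Vx.
by have : (U `&` V) x by []; rewrite UV0.
Qed.

End mass.

(** If all values were below [c / n], at most [n] of them would sum to less than [c]; the list is
    nonempty because [c > 0]. *)
Lemma seq_pigeonhole (R : realFieldType) (T : eqType) (l : seq T) (g : T -> R)
    (n : nat) (c : R) : (size l <= n)%N -> 0 < c -> c <= \sum_(x <- l) g x ->
  exists x, c / n%:R <= g x.
Proof.
move=> ln c0 cl; apply: contrapT => /forallNP h.
have n0 : (0 < n)%N.
  by case: l ln cl => [_|? ? /(leq_ltn_trans _) ->//]; rewrite big_nil leNgt c0.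
have d0 : 0 < c / n%:R by rewrite divr_gt0// ltr0n.
have sum_le (l' : seq T) : \sum_(x <- l') g x <= (size l')%:R * (c / n%:R).
  elim: l' => [|x l' IH]; first by rewrite big_nil mul0r.
  have /negP := h x; rewrite -ltNge => gx.
  by rewrite big_cons -[size _]/((size l').+1) -natr1 mulrDl mul1r; lra.
case: l ln cl => [|x l] ln cl; first by move: cl; rewrite big_nil leNgt c0.
suff : \sum_(y <- x :: l) g y < c by rewrite ltNge cl.
have /negP := h x; rewrite -ltNge => gx.
rewrite big_cons; apply: (lt_le_trans (ltr_leD gx (sum_le l))).
rewrite -[X in X + _]mul1r -mulrDl nat1r mulrA ler_pdivrMr ?ltr0n// mulrC.
by rewrite ler_pM2l// ler_nat.
Qed.

(** * Content of closed sets, and points of large content *)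

Section content.
Context {R : realType} {k : scalar_kind} {X : compactHausdorffType}.
Local Notation K := (scalar_field R k).
Local Notation CX := (Cspace R k X).
Variable phi : {linear CX -> K^o}.
Hypothesis phi_continuous : continuous phi.
Implicit Types (U V F G : set X) (x : X).

(** The total variation on a closed set, read off from its open complement. [mass] cannot serve
    here: it is 0 on any non-isolated point. *)
Definition content F : R := mass phi setT - mass phi (~` F).

Lemma content_le F : content F <= mass phi setT.
Proof. by rewrite gerBl mass_ge0. Qed.

Lemma content_set0 : content set0 = 0.
Proof. by rewrite /content setC0 subrr. Qed.

Lemma content_setT : content setT = mass phi setT.
Proof.
rewrite /content setCT (_ : mass phi set0 = 0) ?subr0//.
apply/eqP; rewrite eq_le mass_ge0// andbT; apply: mass_le => f _ f0.
rewrite (_ : f = 0) ?linear0 ?modulus0//; apply: Cspace_ext => x.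
by rewrite f0.
Qed.

Lemma content_open U F : open U -> closed F -> F `<=` U -> content F <= mass phi U.
Proof. by move=> oU cF FU; rewrite lerBlDr mass_openC. Qed.

(** One inequality comes from small neighbourhoods of [F] and [G], the other from disjoint
    neighbourhoods cut down by a nearly optimal neighbourhood [Q] of the union. *)
Lemma content_disjointU F G : closed F -> closed G -> F `&` G = set0 ->
  content (F `|` G) = content F + content G.
Proof.
move=> cF cG FG0; apply/eqP; rewrite eq_le; apply/andP; split.
  apply/ler_addgt0Pr => e e0.
  have he H : content H < content H + e / 2 by rewrite ltrDl divr_gt0.
  have [U [oU FU] mU] := mass_nbhs phi_continuous cF (he F).
  have [V [oV GV] mV] := mass_nbhs phi_continuous cG (he G).
  have := content_open (openU oU oV) (closedU cF cG) (setUSS FU GV).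
  by have := mass_openU phi_continuous oU oV; move: mU mV; lra.
apply/ler_addgt0Pr => e e0.
have he : content (F `|` G) < content (F `|` G) + e by rewrite ltrDl.
have [Q [oQ FGO] mQ] := mass_nbhs phi_continuous (closedU cF cG) he.
have [U [V [oU oV FU GV UV0]]] := @separate_closed R X _ _ cF cG FG0.
have FUO : F `<=` U `&` Q by move=> x Fx; split; [exact: FU|apply: FGO; left].
have GVO : G `<=` V `&` Q by move=> x Gx; split; [exact: GV|apply: FGO; right].
have UVO0 : (U `&` Q) `&` (V `&` Q) = set0.
  by apply/seteqP; split => // x [[Ux _] [Vx _]]; rewrite -UV0.
have := content_open (openI oU oQ) cF FUO.
have := content_open (openI oV oQ) cG GVO.
have := mass_disjointU phi_continuous UVO0.
have : mass phi ((U `&` Q) `|` (V `&` Q)) <= mass phi Q.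
  by apply: le_mass => // x [[]|[]].
by move: mQ; lra.
Qed.

Lemma content_seq (l : seq X) : uniq l ->
  content [set` l] = \sum_(x <- l) content [set x].
Proof.
elim: l => [_|x l IH /= /andP[xl ul]].
  by rewrite big_nil set_nil content_set0.
have -> : [set` x :: l] = [set x] `|` [set` l].
  apply/seteqP; split => y /=; rewrite inE; first by case/orP => [/eqP|]; [left|right].
  by case=> [->|->]; rewrite ?eqxx ?orbT.
rewrite big_cons content_disjointU ?IH//.
- exact: closed_singleton.
- by apply: finite_set_closed; exact: finite_seq.
- by apply/seteqP; split => // y [/= ->]; apply/negP.
Qed.

Variable eps : R.
Hypothesis phi_norm : dual_norm phi = 1.
Hypothesis eps_bounds : 0 < eps < 4^-1.
Hypothesis phi_dp : disjointness_preserving eps phi.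
Let s : R := Num.sqrt (1 - 4 * eps).

Let eps0 : 0 < eps. Proof. by case/andP: eps_bounds. Qed.

Let s_gt0 : 0 < s.
Proof. by rewrite sqrtr_gt0; case/andP: eps_bounds => _; lra. Qed.

Let s_sqr : s ^+ 2 = 1 - 4 * eps.
Proof. by rewrite sqr_sqrtr//; case/andP: eps_bounds => _; lra. Qed.

(** The two bounds are the roots of [t * (1 - t) = eps]. *)
Lemma mass_gap U : open U ->
  mass phi U <= (1 - s) / 2 \/ (1 + s) / 2 <= mass phi U.
Proof.
move=> oU; set t := mass phi U.
have t1 : t <= 1 by rewrite -phi_norm -mass_setT// le_mass.
suff : t * (1 - t) <= eps.
  move: s_gt0 s_sqr; have [|tlo] := leP t ((1 - s) / 2); first by left.
  by have [|thi] := leP ((1 + s) / 2) t; [right|nra].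
apply/ler_addgt0Pr => e e0.
(* [W] and the complement of [C] are disjoint, with masses at least [t - e] and [1 - t]. *)
have [W [C [oW cC WC CU hW]]] := mass_inner phi_continuous U e0.
have WC0 : W `&` ~` C = set0 by apply/seteqP; split => // x [/WC].
have := mass_disjointness_preserving phi_continuous phi_dp (ltW eps0) WC0.
have := mass_openC phi_continuous oU cC CU; rewrite mass_setT// phi_norm.
have := mass_ge0 phi_continuous (~` C); have := mass_ge0 phi_continuous U.
have := mass_ge0 phi_continuous W.
move: hW; rewrite -/t; set a := mass phi W; set b := mass phi (~` C).
by move=> *; nra.
Qed.

(* Points of content below the gap [s] cannot turn a set of content at most
   [(1 - s) / 2] into one of content at least [(1 + s) / 2]. *)
Lemma content_majority F G : closed F -> closed G ->
  (forall x, ~ F x -> ~ G x -> content [set x] < s) ->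
  (1 + s) / 2 <= content F \/ (1 + s) / 2 <= content G.
Proof.
move=> cF cG small.
have [|Fs] := leP ((1 + s) / 2) (content F); first by left.
have [|Gs] := leP ((1 + s) / 2) (content G); first by right.
have [U [oU FU] mU] := mass_nbhs phi_continuous cF Fs.
have [V [oV GV] mV] := mass_nbhs phi_continuous cG Gs.
(* A mass below the upper end of the gap is at most its lower end. *)
have {mU} mU : mass phi U <= (1 - s) / 2 by case: (mass_gap oU) => //; move: mU; lra.
have {mV} mV : mass phi V <= (1 - s) / 2 by case: (mass_gap oV) => //; move: mV; lra.
have /choice[P hP] : forall x, exists P : set X,
    [/\ open P, P x & P `<=` U `|` V \/ mass phi P < s].
  move=> x; have [Fx|nFx] := pselect (F x).
    by exists U; split => //; [exact: FU|left=> y; left].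
  have [Gx|nGx] := pselect (G x).
    by exists V; split => //; [exact: GV|left=> y; right].
  have [P [oP xP] mP] :=
    mass_nbhs phi_continuous (@closed_singleton X x) (small x nFx nGx).
  by exists P; split => //; [exact: xP|right].
have [x|x|l hl] := @compactHausdorff_cover X P; [by case: (hP x)..|].
(* Starting from [U], the neighbourhoods are added one at a time; a step of mass below [s] cannot
   cross the gap. In the end [Q] and [V] cover [X] with total mass at most [1 - s], a
   contradiction. *)
suff [Q [oQ UQ mQ lQ]] : exists Q : set X, [/\ open Q, U `<=` Q,
    mass phi Q <= (1 - s) / 2 & forall x, x \in l -> P x `<=` Q `|` V].
  have : mass phi setT <= mass phi Q + mass phi V.
    apply: le_trans (mass_openU phi_continuous oQ oV); apply: le_mass => // y _.
    by have [x xl Pxy] := hl y; apply: lQ Pxy.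
  by rewrite mass_setT// phi_norm; move: mQ mV s_gt0; lra.
elim: l {hl} => [|x l [Q [oQ UQ mQ lQ]]]; first by exists U; split.
have [oP _ [PUV|Ps]] := hP x.
  exists Q; split => // y; rewrite inE => /orP[/eqP ->|/lQ//].
  by move=> z /PUV[/UQ|]; [left|right].
exists (Q `|` P x); split.
- exact: openU.
- by move=> y /UQ; left.
- case: (mass_gap (openU oQ oP)) => //.
  by have := mass_openU phi_continuous oQ oP; move: mQ Ps; lra.
- move=> y; rewrite inE => /orP[/eqP ->|/lQ h]; first by move=> z; left; right.
  by move=> z /h[]; [left; left|right].
Qed.

(** Cut [l] into two halves of at most [n] points. By [content_majority] one of them has content at
    least [(1 + s) / 2], and pigeonhole applies to it. *)
Lemma heavy_point_half (l : seq X) (n : nat) : uniq l -> (size l <= n.*2)%N ->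
  (forall x, x \notin l -> content [set x] < s) ->
  exists x, (1 + s) / 2 / n%:R <= content [set x].
Proof.
move=> ul ln small.
have := ul; rewrite -(cat_take_drop n l) cat_uniq => /and3P[ut _ ud].
have c0 : 0 < (1 + s) / 2 by rewrite divr_gt0// ltr_wpDr// ltW.
have cl (l' : seq X) : closed [set` l'].
  by apply: finite_set_closed; exact: finite_seq.
have [x /negP xt /negP xd||] := content_majority (cl (take n l)) (cl (drop n l)).
- by apply: small; rewrite -(cat_take_drop n l) mem_cat negb_or xt.
- rewrite content_seq// => /(seq_pigeonhole _ c0); apply.
  by rewrite size_take_min geq_minl.
- rewrite content_seq// => /(seq_pigeonhole _ c0); apply.
  by rewrite size_drop leq_subLR addnn.
Qed.

(** More than [n.*2] points of content at least [s] would have total content above 1. A list of such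
    points of maximal length therefore exists and contains them all, as [heavy_point_half]
    requires. *)
Lemma heavy_point (n : nat) : (n.*2.+1)%:R^-1 < s ->
  exists x, (1 + s) / 2 / n%:R <= content [set x].
Proof.
move=> hs.
pose heavy l := uniq l /\ forall x : X, x \in l -> s <= content [set x].
have size_heavy l : heavy l -> (size l <= n.*2)%N.
  move=> [ul hl]; rewrite leqNgt; apply/negP => nl.
  have : (size l)%:R * s <= \sum_(x <- l) content [set x].
    elim: l hl {ul nl} => [|x l IH] hl; first by rewrite big_nil mul0r.
    rewrite big_cons -[size _]/((size l).+1) -natr1 mulrDl mul1r addrC.
    by rewrite lerD ?hl ?mem_head ?IH// => y yl; rewrite hl// inE yl orbT.
  rewrite -content_seq// leNgt => /negP; apply.
  apply: le_lt_trans (content_le _) _; rewrite mass_setT// phi_norm.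
  rewrite -ltr_pdivrMl ?mulr1; last by rewrite ltr0n (leq_ltn_trans _ nl).
  apply: le_lt_trans hs; rewrite lef_pV2 ?posrE ?ltr0n ?(leq_ltn_trans _ nl)//.
  by rewrite ler_nat.
pose P m := `[< exists2 l, heavy l & size l = m >].
have exP : exists m, P m by exists 0%N; apply/asboolP; exists [::].
have leP m : P m -> (m <= n.*2)%N by move=> /asboolP[l /size_heavy + <-].
have [m /asboolP[l [ul hl] lm] maxl] := ex_maxnP exP leP.
apply: (heavy_point_half ul); first by apply: size_heavy.
move=> x xl; rewrite ltNge; apply/negP => hx.
have /maxl : P m.+1.
  apply/asboolP; exists (x :: l); last by rewrite /= lm.
  split; first by rewrite /= xl.
  by move=> y; rewrite inE => /orP[/eqP ->|/hl].
by rewrite ltnn.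
Qed.

(** The total content 1 is shared among [size l] points. *)
Lemma heavy_point_finite (l : seq X) : uniq l -> (forall x, x \in l) ->
  exists x, 1 / (size l)%:R <= content [set x].
Proof.
move=> ul hl; apply: (@seq_pigeonhole _ _ l (fun x => content [set x])) => //.
rewrite -content_seq// (_ : [set` l] = setT) ?content_setT ?mass_setT ?phi_norm//.
by apply/seteqP; split => // x _; exact: hl.
Qed.

End content.

Lemma dual_norm_le {R : realType} {k : scalar_kind} {X : compactHausdorffType}
    (psi : Cspace R k X -> (scalar_field R k)^o) (M : R) :
  (forall f : Cspace R k X, (forall x, modulus (f x) <= 1) ->
    modulus (psi f : scalar_field R k) <= M) -> dual_norm psi <= M.
Proof.
move=> hM; apply: ge_sup.
  by exists (modulus (psi 0 : scalar_field R k)), 0 => //=; rewrite normr0.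
by move=> _ [f f1 <-]; apply: hM; apply/norm_le1P.
Qed.

(** * Distance to the multiples of a Dirac functional *)

Section best_dirac_approximation.
Context {R : realType} {k : scalar_kind} {X : compactHausdorffType}.
Local Notation K := (scalar_field R k).
Local Notation CX := (Cspace R k X).
Variable phi : {linear CX -> K^o}.
Hypothesis phi_continuous : continuous phi.

(** [h] vanishes on a closed [C] that carries all but [e] of the mass off [x]; the functions [g] in
    question live off both [C] and [x]. *)
Lemma peak_function (x : X) (e : R) : 0 < e -> exists h : X -> R,
  [/\ continuous h, forall y, 0 <= h y <= 1, h x = 1 &
      forall g : CX, (forall y, modulus (g y) <= 1) -> g x = 0 ->
        (forall y, h y = 0 -> g y = 0) -> modulus (phi g : K) <= e].
Proof.
move=> e0.
have [W [C [oW cC WC Cx hW]]] := mass_inner phi_continuous (~` [set x]) e0.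
have [|h [ch h01 hC hx]] := @Urysohn_function R X _ _ cC (@closed_singleton X x).
  by apply/seteqP; split => // y [/Cx].
exists h; split => //; first exact: hx.
move=> g g1 gx gh.
have g0 y : ~ (~` C `\` [set x]) y -> g y = 0.
  move=> hy; have [Cy|nCy] := pselect (C y); first by rewrite gh// hC.
  by have [->//|yx] := pselect (y = x); case: hy.
apply: le_trans (mass_ub phi_continuous g1 g0) _.
have dis : (~` C `\` [set x]) `&` W = set0.
  by apply/seteqP; split => // y [[nC _] /WC].
have := mass_disjointU phi_continuous dis.
have : mass phi ((~` C `\` [set x]) `|` W) <= mass phi (~` [set x]).
  by apply: le_mass => // y [[]//|/WC/Cx].
by move: hW; lra.
Qed.

(* The Hahn-Banach extension of the restriction of [phi] to the functions
   vanishing at [x] differs from [phi] by a multiple of the evaluation at [x];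
   that multiple is the limit of [phi] along functions peaking at [x]. *)
Lemma best_dirac_approximation (x : X) : exists alpha : K,
  dual_norm (phi \- alpha \*: dirac_functional x) <= mass phi (~` [set x]).
Proof.
have /choice[h hP] : forall e : {posnum R}, exists h : X -> R,
    [/\ continuous h, forall y, 0 <= h y <= 1, h x = 1 &
        forall g : CX, (forall y, modulus (g y) <= 1) -> g x = 0 ->
        (forall y, h y = 0 -> g y = 0) -> modulus (phi g : K) <= e%:num].
  by move=> e; exact: peak_function.
have ch e : continuous (h e) by case: (hP e).
have h0 e y : 0 <= h e y by case: (hP e) => _ /(_ y) /andP[].
have h1 e y : h e y <= 1 by case: (hP e) => _ /(_ y) /andP[].
have hx e : h e x = 1 by case: (hP e).
have hsmall e (g : CX) : (forall y, modulus (g y) <= 1) -> g x = 0 ->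
    (forall y, h e y = 0 -> g y = 0) -> modulus (phi g : K) <= e%:num.
  by case: (hP e) => _ _ _; apply.
pose one : CX := Cspace_one; pose p e := cutoff (ch e) one.
have pE e y : p e y = of_real k (h e y) by rewrite /p cutoffE mulr1.
have [|a ha] :=
    @scalar_common_point R k _ (fun e => phi (p e)) (fun e => e%:num) 1%:pos.
  move=> e e'.
  (* This is [h - h' = h (1 - h') - h' (1 - h)], where both products vanish at [x], so that [hsmall]
     applies. *)
  have -> : (phi (p e) : K) - phi (p e') =
      phi (cutoff (ch e) (one - p e')) - phi (cutoff (ch e') (one - p e)).
    rewrite -!linearB; congr (phi _); apply: Cspace_ext => y.
    by rewrite !(CspaceD, CspaceN, cutoffE, pE, Cspace_oneE); ring.
  apply: le_trans (modulusB _ _) _.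
  have small e1 e2 : modulus (phi (cutoff (ch e1) (one - p e2)) : K) <= e1%:num.
    have E y : cutoff (ch e1) (one - p e2) y = of_real k (h e1 y * (1 - h e2 y)).
      by rewrite cutoffE CspaceD CspaceN pE of_realM of_realD of_realN of_real1.
    apply: hsmall => [y||y]; rewrite E.
    - rewrite modulus_of_real ger0_norm ?mulr_ge0 ?subr_ge0//.
      by rewrite mulr_ile1 ?subr_ge0// gerBl.
    - by rewrite !hx subrr mulr0 of_real0.
    - by move=> ->; rewrite mul0r of_real0.
  by rewrite lerD.
exists a; apply: dual_norm_le => f f1; apply/ler_addgt0Pr => e e0.
have e60 : 0 < e / 4 by rewrite divr_gt0.
(* [f - f x] has modulus up to 2, hence the factor 1/2 in [g]. The terms from [g] and from
   [phi (p d) - a] cost [2 * (e / 4)] each. *)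
pose d := PosNum e60; pose g := (of_real k 2^-1) *: cutoff (ch d) (f - f x *: one).
have fE : (phi \- a \*: dirac_functional x) f =
    of_real k 2 * (phi g : K) + (phi (f - cutoff (ch d) f) : K) +
    (phi (p d) - a) * f x.
  (* With [h] the peak, [f = h (f - f x) + (1 - h) f + (f x) h]; once [a * f x] is subtracted, only
     the middle term, which vanishes at [x], need not be small. *)
  have : f = of_real k 2 *: g + (f - cutoff (ch d) f) + f x *: p d.
    apply: Cspace_ext => y.
    rewrite !(CspaceD, CspaceN, CspaceZ, cutoffE, pE, Cspace_oneE).
    rewrite mulrA -of_realM divff ?pnatr_eq0//.
    by rewrite of_real1; ring.
  move=> /(congr1 phi); rewrite linearD linearD !linearZ /= => {1}->.
  by rewrite /dirac_functional /= /GRing.scale /=; ring.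
rewrite fE; apply: le_trans (modulusD _ _) _; rewrite modulusM.
apply: le_trans (lerD (modulusD _ _) (lexx _)) _; rewrite modulusM.
rewrite modulus_of_real ger0_norm//.
have A1 : modulus (phi g : K) <= e / 4.
  apply: (hsmall d) => [y||y hy].
  - rewrite CspaceZ modulusM modulus_of_real ger0_norm ?invr_ge0//.
    rewrite mulrC ler_pdivrMr// mul1r.
    apply: le_trans (modulus_cutoff _ _ _) _; first by rewrite h0 h1.
    rewrite CspaceD CspaceN; apply: le_trans (modulusB _ _) _.
    by rewrite CspaceZ mulr1 (_ : 2 = 1 + 1)// lerD.
  - by rewrite CspaceZ cutoffE CspaceD CspaceN CspaceZ mulr1 subrr !mulr0.
  - by rewrite CspaceZ cutoffE hy of_real0 mul0r mulr0.
have A2 : modulus (phi (f - cutoff (ch d) f) : K) <= mass phi (~` [set x]).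
  have E y : (f - cutoff (ch d) f) y = of_real k (1 - h d y) * f y.
    by rewrite CspaceD CspaceN cutoffE of_realD of_realN of_real1 mulrBl mul1r.
  apply: mass_ub => // y; rewrite E.
    rewrite modulusM modulus_of_real ger0_norm ?subr_ge0//.
    by rewrite mulr_ile1 ?subr_ge0 ?modulus_ge0// gerBl.
  by move=> /contrapT ->; rewrite hx subrr of_real0 mul0r.
have A3 : modulus (phi (p d) - a : K) * modulus (f x) <= 2 * (e / 4).
  by apply: le_trans (ha d); rewrite ler_piMr ?modulus_ge0.
by move: A1 A2 A3; lra.
Qed.

End best_dirac_approximation.

(** * Functionals given by finitely many point weights *)

Section discrete_functional.
Context {R : realType} {k : scalar_kind} {X : compactHausdorffType}.
Local Notation K := (scalar_field R k).
Local Notation CX := (Cspace R k X).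
Variables (l : seq X) (w : X -> R).
Implicit Types f g : CX.

Definition discrete_functional : CX -> K^o :=
  fun f => \sum_(x <- l) of_real k (w x) * f x.

Let discrete_linear : linear discrete_functional.
Proof.
move=> a f g; rewrite /discrete_functional.
have -> : a *: ((\sum_(x <- l) of_real k (w x) * f x) : K^o) =
  \sum_(x <- l) a * (of_real k (w x) * f x) by exact: mulr_sumr.
rewrite -big_split /=.
by apply: eq_bigr => x _; rewrite CspaceD CspaceZ; ring.
Qed.

HB.instance Definition _ :=
  GRing.isLinear.Build K CX K^o *:%R discrete_functional discrete_linear.

Hypothesis w_ge0 : forall x, 0 <= w x.
Hypothesis w_sum : \sum_(x <- l) w x = 1.

Lemma modulus_discrete f :
  modulus (discrete_functional f : K) <= \sum_(x <- l) w x * modulus (f x).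
Proof.
rewrite /discrete_functional; elim: l => [|x s IH].
  by rewrite !big_nil modulus0.
rewrite !big_cons (le_trans (modulusD _ _))// lerD//.
by rewrite modulusM modulus_of_real ger0_norm.
Qed.

Lemma modulus_discrete_support f : (forall x, modulus (f x) <= 1) ->
  modulus (discrete_functional f : K) <= \sum_(x <- l | f x != 0) w x.
Proof.
move=> f1; apply: le_trans (modulus_discrete f) _.
rewrite [leRHS]big_mkcond; apply: ler_sum => x _.
by case: eqVneq => [->|_]; rewrite ?modulus0 ?mulr0// ler_piMr.
Qed.

Lemma modulus_discrete_le1 f : (forall x, modulus (f x) <= 1) ->
  modulus (discrete_functional f : K) <= 1.
Proof.
move=> f1; apply: le_trans (modulus_discrete f) _.
by rewrite -w_sum; apply: ler_sum => x _; rewrite ler_piMr.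
Qed.

Lemma discrete_continuous : continuous discrete_functional.
Proof.
apply: bounded_linear_continuous; apply/linear_boundedP.
exists 1; split => // r r1 f; rewrite (@le_trans _ _ `|f|)//; last first.
  by rewrite ler_peMl// ltW.
rewrite [leLHS]modulusE CspaceE ler_of_real (le_trans (modulus_discrete f))//.
rewrite -[leRHS]mul1r -w_sum mulr_suml; apply: ler_sum => x _.
by rewrite ler_wpM2l// sup_norm_ub.
Qed.

Lemma discrete_norm : dual_norm discrete_functional = 1.
Proof.
apply/eqP; rewrite eq_le; apply/andP; split.
  by apply: dual_norm_le => f; exact: modulus_discrete_le1.
apply: ub_le_sup; first exact: (dual_norm_has_ubound discrete_continuous).
exists (Cspace_one : CX).
  by apply/norm_le1P => x; rewrite Cspace_oneE modulus1.
rewrite /discrete_functional.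
rewrite (_ : \sum_(x <- l) _ = of_real k 1) ?modulus_of_real ?normr1//.
by rewrite -w_sum of_real_sum; apply: eq_bigr => x _; rewrite Cspace_oneE mulr1.
Qed.

(** Take for [P] the support of [f]: the value at [f] is at most [t] in modulus, and that at [g],
    which lives off [P], at most [1 - t]. *)
Lemma discrete_disjointness_preserving (eps : R) :
  (forall P : pred X, let t := \sum_(x <- l | P x) w x in t * (1 - t) <= eps) ->
  disjointness_preserving eps discrete_functional.
Proof.
move=> gap f g f1 g1 fg0.
have lef : forall x, modulus (f x) <= 1 by apply/norm_le1P; rewrite f1.
have leg : forall x, modulus (g x) <= 1 by apply/norm_le1P; rewrite g1.
apply: le_trans (gap (fun x => f x != 0)).
apply: ler_pM; rewrite ?modulus_ge0 ?modulus_discrete_support//.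
apply: le_trans (modulus_discrete_support leg) _.
rewrite -w_sum [X in _ <= X - _](bigID (fun x => f x != 0))/= addrAC subrr add0r.
rewrite [leLHS]big_mkcond [leRHS]big_mkcond; apply: ler_sum => x _.
have [_|fx] /= := eqVneq (f x) 0; first by case: ifP.
by have /eqP := fg0 x; rewrite mulf_eq0 (negbTE fx) /= => /eqP ->; rewrite eqxx.
Qed.

(** A function that is 0 at [x] and 1 at the other points of [l] does not see the Dirac term and
    collects all weight except that of [x]. *)
Lemma discrete_far_from_dirac (c : R) (alpha : K) (x : X) : uniq l ->
  (forall y, w y <= c) ->
  1 - c <= dual_norm (discrete_functional \- alpha \*: dirac_functional x).
Proof.
move=> ul wc.
have fin : finite_set ([set` l] `\ x) by apply: finite_setD; exact: finite_seq.
have [|h [ch h01 h0 h1]] := @Urysohn_function R X _ _ (@closed_singleton X x)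
  (finite_set_closed fin).
  by apply/seteqP; split => // y [-> [_ /(_ erefl)]].
pose f : CX := cutoff ch Cspace_one.
have fE y : f y = of_real k (h y) by rewrite /f cutoffE mulr1.
have f1 y : modulus (f y) <= 1.
  by rewrite fE modulus_of_real; have /andP[? ?] := h01 y; rewrite ger0_norm.
apply: (@le_trans _ _ (modulus
    ((discrete_functional \- alpha \*: dirac_functional x) f : K))); last first.
  apply: ub_le_sup; last by exists f => //; exact/norm_le1P.
  (* Without an upper bound the supremum would take its default value 0. *)
  exists (1 + modulus alpha) => _ [g /norm_le1P g1 <-].
  apply: le_trans (modulusB _ _) _; rewrite lerD ?modulus_discrete_le1//.
  rewrite [leLHS]modulusM. by rewrite ler_piMr ?modulus_ge0 ?g1.
rewrite /= /dirac_functional fE h0// of_real0 scaler0 subr0.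
rewrite (_ : discrete_functional f = of_real k (\sum_(y <- l | y != x) w y)).
  rewrite modulus_of_real (le_trans _ (ler_norm _))// lerBlDl -w_sum.
  rewrite (bigID (fun y => y == x))/= lerD2r.
  have [xl|xl] := boolP (x \in l); first by
    rewrite big_mkcond (bigD1_seq x)//= eqxx big1 ?addr0// => y /negbTE ->.
  rewrite big1_seq ?(le_trans (w_ge0 x))// => y /andP[/eqP -> yl].
  by rewrite yl in xl.
rewrite /discrete_functional [in RHS]big_mkcond of_real_sum.
rewrite big_seq [RHS]big_seq; apply: eq_bigr => y yl; rewrite fE.
have [->|yx] := eqVneq y x; first by rewrite h0// of_real0 mulr0.
by rewrite h1 ?of_real1 ?mulr1//; split => //; exact/eqP.
Qed.

End discrete_functional.

(** Since [omega m = (1 - 1/m^2) / 4]. It turns membership of [eps] in [bbA n] into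
    [1/(2n+1) < s <= 1/(2n-1)]. *)
Lemma sqrt_omega (R : realType) (eps : R) (m : nat) : (0 < m)%N -> eps <= 4^-1 ->
  (omega m <= eps) = (Num.sqrt (1 - 4 * eps) <= m%:R^-1).
Proof.
move=> m0 e4; have mR : 0 < m%:R :> R by rewrite ltr0n.
have omE : omega m = (1 - m%:R^-1 ^+ 2) / 4 :> R.
  by rewrite /omega; field; rewrite gt_eqF.
have mi : 0 <= m%:R^-1 :> R by rewrite invr_ge0 ltW.
rewrite -[m%:R^-1 in RHS](ger0_norm mi) -sqrtr_sqr ler_sqrt ?sqr_ge0// omE.
by rewrite ler_pdivrMr//; apply/idP/idP; lra.
Qed.

Lemma card_le_uniq_seq (T : choiceType) (n : nat) : (`I_n #<= [set: T])%card ->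
  exists2 l : seq T, uniq l & size l = n.
Proof.
move=> nT; have [D nD] : exists D : {fset T}, (n <= #|` D|)%N.
  have [fT|/(@infinite_set_fset _ _ n)[D _ nD]] := pselect (finite_set [set: T]).
    by exists (fset_set [set: T]); exact: leq_card_fset_set.
  by exists D.
exists (take n (enum_fset D)); first exact/take_uniq/fset_uniq.
by rewrite size_take_min; apply/minn_idPl.
Qed.

(** * Weights attaining the bound *)

Section weights.
Context {R : realType} {T : eqType}.
Variable eps : R.
Hypothesis eps_le : eps <= 4^-1.
Let s : R := Num.sqrt (1 - 4 * eps).

Let s_ge0 : 0 <= s. Proof. exact: sqrtr_ge0. Qed.

Let s_sqr : s ^+ 2 = 1 - 4 * eps.
Proof. by rewrite sqr_sqrtr//; move: eps_le; lra. Qed.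

(** The cap [c] yields distance at least [1 - c] from all Dirac multiples; the last clause keeps the
    weight of every subset out of the gap. *)
Definition extremal_weights (l : seq T) (c : R) (w : T -> R) :=
  [/\ forall x, 0 <= w x <= c, \sum_(x <- l) w x = 1 &
      forall P : pred T, let t := \sum_(x <- l | P x) w x in t * (1 - t) <= eps].

Let gap (t : R) : t <= (1 - s) / 2 \/ (1 + s) / 2 <= t -> t * (1 - t) <= eps.
Proof. by move: s_ge0 s_sqr => ? ? [] ?; nra. Qed.

Let sum_const (l : seq T) (P : pred T) (c : R) :
  \sum_(x <- l | P x) c = (count P l)%:R * c.
Proof. by rewrite big_const_seq iter_addr_0 mulr_natl. Qed.

(** Under uniform weights the subset weights nearest to 1/2 are [(k - 1) / (2k)] and
    [(k + 1) / (2k)], as [k] is odd. They are [1/k >= s] apart, so the gap fits between them. *)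
Lemma extremal_weights_odd (l : seq T) : odd (size l) ->
  s <= (size l)%:R^-1 -> exists w, extremal_weights l (size l)%:R^-1 w.
Proof.
set k := size l => k_odd sk; have k0 : 0 < k%:R :> R by rewrite ltr0n odd_gt0.
exists (fun=> k%:R^-1); split => [x||P].
- by rewrite lexx andbT invr_ge0 ltW.
- by rewrite sum_const count_predT divff// gt_eqF.
apply: gap; rewrite sum_const; set m := count P l.
have kE : k%:R = 2 * (k./2)%:R + 1 :> R.
  by rewrite -[k in LHS]odd_double_half k_odd add1n -natr1 -muln2 natrM; ring.
have ik : k%:R * k%:R^-1 = 1 :> R by rewrite divff// gt_eqF.
have i0 : 0 < k%:R^-1 :> R by rewrite invr_gt0.
have [mk|mk] := leqP m k./2; [left|right].
  have : m%:R <= (k./2)%:R :> R by rewrite ler_nat.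
  move: sk ik i0 kE; set i := k%:R^-1; set K := k%:R; set a := (k./2)%:R; set b := m%:R.
  by move=> *; nra.
have : (k./2)%:R + 1 <= m%:R :> R by rewrite natr1 ler_nat.
move: sk ik i0 kE; set i := k%:R^-1; set K := k%:R; set a := (k./2)%:R; set b := m%:R.
by move=> *; nra.
Qed.

(* All points but one have the maximal weight, so that any [j] of them just
   reach the upper end of the gap and the rest its lower end. *)
Lemma extremal_weights_even (l : seq T) (j : nat) : (0 < j)%N -> uniq l ->
  size l = j.*2 -> s <= (j.*2.-1)%:R^-1 ->
  exists w, extremal_weights l ((1 + s) / 2 / j%:R) w.
Proof.
case: j => // j _; set a : R := (1 + s) / 2 / j.+1%:R.
case: l => // z l /= /andP[zl _] [lj] sj.
have j0 : 0 < j.+1%:R :> R by rewrite ltr0n.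
have aj : j.+1%:R * a = (1 + s) / 2 by rewrite mulrC divfK// gt_eqF.
have a0 : 0 < a by rewrite !divr_gt0// ltr_wpDr.
(* [b] is what is left for the exceptional point [z]. As [2 * j.+1 * a = 1 + s], it equals [a - s],
   which is nonnegative because [n * s <= 1]. *)
pose n : R := (size l)%:R; pose b := 1 - n * a.
have nE : n = 2 * j.+1%:R - 1.
  by rewrite /n lj -[j.*2.+1]addn1 -[j.+1]addn1 -muln2 !natrD natrM; ring.
have n0 : 0 < n by rewrite /n lj ltr0n.
have sn : n * s <= 1.
  by rewrite mulrC -ler_pdivlMr// mul1r /n lj.
have bE : b = a - s.
  by rewrite /b nE mulrBl mul1r -mulrA aj; field.
have b0 : 0 <= b by rewrite /b nE; nra.
have ba : b <= a by rewrite bE; move: s_ge0; lra.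
have w_tail P : \sum_(x <- l | P x) (if x == z then b else a) = (count P l)%:R * a.
  rewrite -sum_const big_seq_cond [RHS]big_seq_cond.
  by apply: eq_bigr => x /andP[xl _]; case: eqVneq xl zl => // -> ->.
exists (fun x => if x == z then b else a); split => [x||P].
- by case: ifP => _; rewrite ?b0 ?ba ?lexx ?ltW.
- by rewrite big_cons eqxx w_tail count_predT /b subrK.
apply: gap; rewrite big_cons eqxx w_tail; set m := (count P l)%:R.
have [mj|mj] := leqP (count P l) j.
  (* With [z] the weight is [m * a + b = (m + 1) * a - s], and without [z] it is no larger. *)
  left; have : (m + 1) * a <= j.+1%:R * a.
    by rewrite ler_wpM2r ?(ltW a0)// /m natr1 ler_nat.
  by rewrite aj mulrDl mul1r; case: ifP => _; lra.
right; have : j.+1%:R * a <= m * a by rewrite ler_wpM2r ?(ltW a0)// ler_nat.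
by rewrite aj; case: ifP => _; lra.
Qed.

End weights.

(* Both halves of the theorem are about [1 - oX X eps], the guaranteed mass of
   the heaviest point. *)
Lemma oX_cases (R : realType) (X : topologicalType) (eps : R) (x0 : X) :
  0 < eps < 4^-1 -> let s := Num.sqrt (1 - 4 * eps) in
  [\/ exists n (l : seq X), [/\ (0 < n)%N, n.*2.+1%:R^-1 < s <= n.*2.-1%:R^-1,
        uniq l, size l = n.*2 & oX X eps = 1 - (1 + s) / 2 / n%:R],
      exists j (l : seq X), [/\ (0 < j)%N, s <= j.*2.-1%:R^-1,
        uniq l /\ (forall x, x \in l), size l = j.*2 &
        oX X eps = 1 - (1 + s) / 2 / j%:R] |
      exists l : seq X, [/\ odd (size l), s <= (size l)%:R^-1,
        uniq l /\ (forall x, x \in l) & oX X eps = 1 - (size l)%:R^-1]].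
Proof.
move=> /andP[e0 e1] s.
have [|n n0 An] := @bbA_cover R eps; first by rewrite ltW.
have sqrt_om := fun m m0 => @sqrt_omega R eps m m0 (ltW e1).
have odd0 : (0 < n.*2.-1)%N by case: n n0 {An}.
have [s_lo s_hi] : n.*2.+1%:R^-1 < s /\ s <= n.*2.-1%:R^-1.
  by case/andP: An => lo hi; rewrite -sqrt_om// lo ltNge -sqrt_om// -ltNge.
(* Applied, when [X] has fewer than [n.*2] points, to their number if it is odd and to its
   predecessor if it is even. *)
have s_small m : (0 < m)%N -> (m < n.*2)%N -> s <= m%:R^-1.
  move=> m0 mn; apply: le_trans s_hi _; rewrite lef_pV2 ?posrE ?ltr0n// ler_nat.
  by move: mn; clear; lia.
rewrite /oX (bbA_indexE n0 An) -/s; case: ifPn => [|card_lt].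
  move=> /card_le_uniq_seq[l ul ln].
  apply: Or31; exists n, l; split => //; first by rewrite s_lo.
  by field; rewrite pnatr_eq0 -lt0n.
have fX : finite_set [set: X].
  apply: contrapT => /infiniteP; apply/negP; apply: contra card_lt => iX.
  by apply: card_le_trans iX; exact: card_leT.
set D := fset_set [set: X]; pose l := enum_fset D.
have Dl x : x \in l by rewrite -[_ \in _]/(x \in D) in_fset_set// in_setT.
have ul : uniq l by exact: fset_uniq.
have lk : size l = #|` D| by [].
have k0 : (0 < #|` D|)%N by rewrite -lk; case: (l) (Dl x0).
have kn : (#|` D| < n.*2)%N.
  rewrite ltnNge; apply: contra card_lt => nD.
  have : ([set: X] #= `I_#|` D|)%card.
    by have [m hm] := fX; rewrite /D (card_fset_set hm).
  rewrite card_eq_le => /andP[_ h]; apply: card_le_trans h.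
  by rewrite card_le_II.
have kR : #|` D|%:R != 0 :> R by rewrite pnatr_eq0 -lt0n.
case: ifPn => [k_odd|/negbTE k_even].
  apply: Or33; exists l; rewrite lk; split => //; first exact: s_small.
  by field.
have kE : #|` D| = (#|` D|)./2.*2 by rewrite -[LHS]odd_double_half k_even.
apply: Or32; exists (#|` D|)./2, l; split => //.
- by rewrite half_gt0; case: #|` D| k_even k0 => [|[|]].
- rewrite -kE; apply: s_small; last exact: leq_ltn_trans (leq_pred _) kn.
  by case: #|` D| k_even k0 => [|[|]].
- rewrite [in LHS]kE -muln2 natrM; field.
  rewrite pnatr_eq0; apply: contra kR => /eqP h.
  by rewrite kE h.
Qed.

Theorem theorem5p1 (R : realType) (k : scalar_kind) (X : compactHausdorffType)
    (eps : R) (X_ge2 : exists x y : X, x != y) (eps_bounds : 0 < eps < 1 / 4) :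
  (forall phi : {linear Cspace R k X -> (scalar_field R k)^o},
    continuous phi -> disjointness_preserving eps phi -> dual_norm phi = 1 ->
    exists (alpha : scalar_field R k) (x : X),
      dual_norm (phi \- alpha \*: dirac_functional x) <= oX X eps)
  /\
  (exists phi : {linear Cspace R k X -> (scalar_field R k)^o},
    [/\ continuous phi, disjointness_preserving eps phi, dual_norm phi = 1 &
      forall (alpha : scalar_field R k) (x : X),
        oX X eps <= dual_norm (phi \- alpha \*: dirac_functional x)]).
Proof.
have [x0 _] := X_ge2; rewrite div1r in eps_bounds.
have cases := @oX_cases R X eps x0 eps_bounds.
have eps_le : eps <= 4^-1 by case/andP: eps_bounds => _ /ltW.
split => [phi cphi dphi nphi|].
  have [x hx] : exists x, 1 - oX X eps <= content phi [set x].
    case: cases => [[n [l [n0 /andP[s_lo _] ul ln ->]]]|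
        [j [l [j0 _ [ul lX] lj ->]]]|[l [_ _ [ul lX] ->]]]; rewrite subKr.
    - exact: (heavy_point cphi nphi eps_bounds dphi).
    (* [l] lists all of [X], so no point outside it has to be checked. *)
    - apply: (heavy_point_half cphi nphi eps_bounds dphi ul); first by rewrite lj.
      by move=> x; rewrite lX.
    - by rewrite -div1r; exact: (heavy_point_finite cphi nphi).
  have [alpha halpha] := best_dirac_approximation cphi x.
  exists alpha, x; apply: le_trans halpha _.
  (* The mass off [x] is 1 minus the content of [x]. *)
  by move: hx; rewrite /content mass_setT// nphi; lra.
(* The cap [1 - oX X eps] is what makes [discrete_far_from_dirac] give the distance [oX X eps]. *)
have [l [w [ul [w01 w1 wgap]]]] : exists (l : seq X) (w : X -> R),
    uniq l /\ extremal_weights eps l (1 - oX X eps) w.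
  case: cases => [[n [l [n0 /andP[_ hs] ul ln ->]]]|
      [j [l [j0 hs [ul _] lj ->]]]|[l [l_odd hs [ul _] ->]]];
    exists l; rewrite subKr.
  - by have [w hw] := extremal_weights_even eps_le n0 ul ln hs; exists w.
  - by have [w hw] := extremal_weights_even eps_le j0 ul lj hs; exists w.
  - by have [w hw] := extremal_weights_odd eps_le l_odd hs; exists w.
have w0 x : 0 <= w x by case/andP: (w01 x).
exists (discrete_functional l w); split.
- exact: discrete_continuous.
- exact: discrete_disjointness_preserving.
- exact: discrete_norm.
- move=> alpha x; rewrite -[leLHS](subKr 1).
  by apply: discrete_far_from_dirac => // y; case/andP: (w01 y).
Qed.
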